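(* Let $k$ be a positive integer. Every $k$-connected graph $G$ with $\delta(G)\ge k+1$ contains a $k$-removable matching of size $\left\lceil(\delta(G)+1)/2\right\rceil$, unless either $k=1$ and $G$ is a cycle, or $\delta(G)$ is even and $G\cong K_{\delta(G)+1}$.
   Context: All graphs are finite, undirected and simple. $\delta(G)$ is the minimum degree of $G$. A graph is $k$-connected in the usual sense: it has more than $k$ vertices and deleting any set of fewer than $k$ vertices leaves a connected graph. For a $k$-connected graph $G$, a matching $M\subseteq E(G)$ (a set of pairwise vertex-disjoint edges) is called $k$-removable if the graph $G-M$, obtained from $G$ by deleting the edges in $M$ (keeping all vertices), is $k$-connected. The size of a matching is its number of edges. *)

(* Defs.v *)
From mathcomp Require Import all_boot.

Set Implicit Arguments.
Unset Strict Implicit.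
Unset Printing Implicit Defensive.

Record sgraph := SGraph {
  vertex :> finType;
  adj : rel vertex;
  adj_sym : symmetric adj;
  adj_irrefl : irreflexive adj }.

Arguments adj {s} _ _.

Definition edges (G : sgraph) : {set {set G}} :=
  [set [set p.1; p.2] | p : G * G & adj p.1 p.2].

Definition degree (G : sgraph) (x : G) : nat := #|[set y | adj x y]|.

(* Every degree is smaller than #|G|, so the default value #|G| only matters
   for the graph without vertices. *)
Definition min_degree (G : sgraph) : nat :=
  \big[minn/#|G|]_(x : G) degree x.

Section DelVertices.
Variables (G : sgraph) (S : {set G}).
Definition del_vertices_adj : rel {x : G | x \notin S} :=
  fun x y => adj (val x) (val y).
Lemma del_vertices_sym : symmetric del_vertices_adj.
Proof. by move=> x y; apply: adj_sym. Qed.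
Lemma del_vertices_irrefl : irreflexive del_vertices_adj.
Proof. by move=> x; apply: adj_irrefl. Qed.
Definition del_vertices : sgraph :=
  SGraph del_vertices_sym del_vertices_irrefl.
End DelVertices.

Section DelEdges.
Variables (G : sgraph) (M : {set {set G}}).
Definition del_edges_adj : rel G :=
  fun x y => adj x y && ([set x; y] \notin M).
Lemma del_edges_sym : symmetric del_edges_adj.
Proof. by move=> x y; rewrite /del_edges_adj adj_sym setUC. Qed.
Lemma del_edges_irrefl : irreflexive del_edges_adj.
Proof. by move=> x; rewrite /del_edges_adj adj_irrefl. Qed.
Definition del_edges : sgraph := SGraph del_edges_sym del_edges_irrefl.
End DelEdges.

Definition connected (G : sgraph) : Prop :=
  forall x y : G, connect adj x y.

Definition k_connected (k : nat) (G : sgraph) : Prop :=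
  k < #|G| /\ forall S : {set G}, #|S| < k -> connected (del_vertices S).

Definition matching (G : sgraph) (M : {set {set G}}) : Prop :=
  M \subset edges G /\ trivIset M.

Definition k_removable (k : nat) (G : sgraph) (M : {set {set G}}) : Prop :=
  matching M /\ k_connected k (del_edges M).

Definition isomorphic (G H : sgraph) : Prop :=
  exists2 f : G -> H, bijective f & forall x y, adj (f x) (f y) = adj x y.

Section Complete.
Variable n : nat.
Definition complete_adj : rel 'I_n := fun x y => x != y.
Lemma complete_sym : symmetric complete_adj.
Proof. by move=> x y; rewrite /complete_adj eq_sym. Qed.
Lemma complete_irrefl : irreflexive complete_adj.
Proof. by move=> x; rewrite /complete_adj eqxx. Qed.
Definition complete_graph : sgraph := SGraph complete_sym complete_irrefl.
End Complete.

(* ordS is the successor modulo n; the condition x != y only matters for n = 1,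
   and this is the cycle of length n when 2 < n. *)
Section Cycle.
Variable n : nat.
Definition cycle_adj : rel 'I_n :=
  fun x y => (x != y) && ((y == ordS x) || (x == ordS y)).
Lemma cycle_sym : symmetric cycle_adj.
Proof. by move=> x y; rewrite /cycle_adj eq_sym orbC. Qed.
Lemma cycle_irrefl : irreflexive cycle_adj.
Proof. by move=> x; rewrite /cycle_adj eqxx. Qed.
Definition cycle_graph : sgraph := SGraph cycle_sym cycle_irrefl.
End Cycle.

Definition is_cycle (G : sgraph) : Prop :=
  exists2 n, 2 < n & isomorphic G (cycle_graph n).

(* Main.v *)
Require Import Defs.
From mathcomp Require Import all_boot zify.

(* If an edge [pq] of a k-connected graph cannot be removed, some [T] with
   [#|T| < k] splits the other vertices into [A], containing [p], and [B], containing
   [q], with no other edge between [A] and [B].  Along a path of such edges whose inner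
   vertices have degree above [k], the sides containing the starting point grow
   strictly (Mader), so that these edges form a forest.

   Let [M] be a removable matching with no removable matching of size [#|M| + 1], let
   [X] be the set of covered vertices and [U] its complement, and assume that
   [2 #|M|] is at most the minimum degree [d].  Then the graph induced on [U] is a
   forest.  When [U] has at most one vertex, the graph is complete.  A leaf [u] of the
   forest, with neighbour [v], is adjacent to all of [X] but at most one vertex, so the
   cut of [uv] is essentially determined: [d = 2 #|M| = k + 1], and there is an edge
   [xy] of [M] such that [u] misses exactly [x] in [X] while all of [U] except [u]
   misses [y].  Hence there are two leaves [u], [b], attached to the two ends of [xy].
   If [M] has another edge [zz'], the cycle [u z b z'] in the graph where [zz'] has been
   put back contains a removable edge; exchanging it with [zz'] yields a matching of the
   same size for which this description fails.  If [xy] is the only edge of [M], the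
   forest is a path which [xy] closes into a cycle. *)

Set Implicit Arguments.
Unset Strict Implicit.
Unset Printing Implicit Defensive.

(** * Cuts through a single edge *)

Section Cuts.
Variables (V : finType) (k : nat).
Implicit Types (e : rel V) (A B C D W Q : {set V}).

Definition separation e A B :=
  [&& A != set0, B != set0, [disjoint A & B] &
      [forall a in A, forall b in B, ~~ e a b]].

(** Connectivity through vertex partitions instead of induced subgraphs: all relations live on the
    same type, so edges can be deleted and restored freely. *)
Definition kconn e :=
  (k < #|V|) &&
  [forall A : {set V}, forall B : {set V},
     separation e A B ==> (k <= #|~: (A :|: B)|)].

Definition del_edge e p q : rel V :=
  fun x y => e x y && ([set x; y] != [set p; q]).

Definition deg_in e W x := #|[set y in W | e x y]|.

(** The separator is kept implicit as the complement of [A :|: B]; naming both sides makes it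
    possible to reverse a cut and to compare side sizes. *)
Record cut e p q A B : Prop := Cut {
  cut_disj : forall z, z \in A -> z \in B -> False;
  cut_l : p \in A;
  cut_r : q \in B;
  cut_small : #|~: (A :|: B)| < k;
  cut_cross : forall a b, a \in A -> b \in B -> e a b -> a = p /\ b = q }.

Lemma card_indicator A : #|A| = \sum_z (z \in A : nat).
Proof. by rewrite -sum1_card big_mkcond; apply: eq_bigr => z _; case: (z \in A). Qed.

Lemma disj_at A B (t : V) :
  (forall z, z \in A -> z \in B -> False) -> ~~ ((t \in A) && (t \in B)).
Proof. by move=> dAB; apply/andP=> -[/dAB]. Qed.

Lemma kconn_bound e A B a b :
    kconn e -> a \in A -> b \in B -> (forall z, z \in A -> z \in B -> False) ->
    (forall a b, a \in A -> b \in B -> e a b -> False) ->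
  k <= #|~: (A :|: B)|.
Proof.
case/andP=> _ /forallP/(_ A)/forallP/(_ B)/implyP sepk aA bB dAB nAB.
apply: sepk; apply/and4P; split.
- by apply/set0Pn; exists a.
- by apply/set0Pn; exists b.
- by apply/pred0P => z /=; apply/andP => -[/dAB].
- by apply/forall_inP=> u uA; apply/forall_inP=> v vB; apply/negP=> /(nAB _ _ uA vB).
Qed.

Lemma kconn_sub e e' : subrel e e' -> kconn e -> kconn e'.
Proof.
move=> ee' ek; have/andP[kV _] := ek.
apply/andP; split=> //; apply/forallP=> A; apply/forallP=> B; apply/implyP.
case/and4P=> /set0Pn[a aA] /set0Pn[b bB] /pred0P dAB /forall_inP nAB.
apply: kconn_bound ek aA bB _ _ => [z zA zB|u v uA vB /ee' euv].
  by have:= dAB z; rewrite /= zA zB.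
by have/forall_inP/(_ v vB) := nAB u uA; rewrite euv.
Qed.

Lemma cut_sym e p q A B : symmetric e -> cut e p q A B -> cut e q p B A.
Proof.
move=> eC [dAB pA qB sT cr]; split=> //; first by move=> z zB zA; apply: dAB zA zB.
  by rewrite setUC.
by move=> b a bB aA; rewrite eC => /(cr _ _ aA bB)[].
Qed.

(** A small separation of the graph without [pq] is not one of the graph itself, so some edge
    crosses it. That edge can only be [pq], and the two sides are ordered according to its
    orientation. *)
Lemma kconn_del_or_cut e p q :
    symmetric e -> kconn e ->
  kconn (del_edge e p q) \/ exists A B, cut e p q A B.
Proof.
move=> eC ek; have/andP[kV _] := ek.
case: (boolP (kconn (del_edge e p q))) => [|nk]; [by left | right].
move: nk; rewrite negb_and kV /= => /forallPn[A] /forallPn[B].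
rewrite negb_imply -ltnNge.
case/andP=> /and4P[/set0Pn[a aA] /set0Pn[b bB] /pred0P dAB /forall_inP nAB] sT.
have dAB' z : z \in A -> z \in B -> False.
  by move=> zA zB; have := dAB z; rewrite /= zA zB.
have cr u v : u \in A -> v \in B -> e u v -> [set u; v] = [set p; q].
  move=> uA vB euv; have/forall_inP/(_ v vB) := nAB u uA.
  by rewrite /del_edge euv negbK => /eqP.
have [/existsP[u /existsP[v /and3P[uA vB euv]]]|/existsPn nex] :=
    boolP [exists u, exists v, [&& u \in A, v \in B & e u v]]; last first.
  suff : k <= #|~: (A :|: B)| by rewrite leqNgt sT.
  apply: kconn_bound ek aA bB dAB' _ => u v uA vB euv.
  by have/existsPn/(_ v) := nex u; rewrite uA vB euv.
have uv := cr u v uA vB euv.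
have cr' c d : c \in A -> d \in B -> e c d -> c = u /\ d = v.
  move=> cA dB /(cr _ _ cA dB); rewrite -uv => E; split.
    have: c \in [set u; v] by rewrite -E set21.
    by rewrite !inE => /orP[/eqP//|/eqP cv]; case: (dAB' v); rewrite // -cv.
  have: d \in [set u; v] by rewrite -E set22.
  by rewrite !inE => /orP[/eqP du|/eqP//]; case: (dAB' u); rewrite // -du.
have cutuv : cut e u v A B by [].
have vu : v != u by apply/eqP=> vu; apply: (dAB' u uA); rewrite -vu.
have := set21 u v; have := set22 u v; rewrite uv !inE.
case/orP=> /eqP vE /orP[]/eqP uE; first by rewrite vE uE eqxx in vu.
- by exists B, A; rewrite -uE -vE; apply: cut_sym.
- by exists A, B; rewrite -uE -vE.
by rewrite vE uE eqxx in vu.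
Qed.

(* With [T] and [S] the two separators, the corners [B :&: C] and [A :&: D] have
   boundaries of total size [#|T| + #|S| <= 2k - 2], while that of [A :&: D], which
   contains [x], has at least [k - 1] elements since [x] has degree above [k]. *)
Lemma cut_chain e w x y A B C D :
    symmetric e -> irreflexive e -> kconn e -> e w x -> e x y -> w != y -> k < deg_in e setT x ->
    cut e w x C D -> cut e x y A B ->
  #|C| < #|A|.
Proof.
move=> eC eI ek ewx exy wy degx [dCD wC xD sS crS] [dAB xA yB sT crT].
have wB : w \notin B.
  by apply/negP=> wB; have [|_ /eqP] := crT x w xA wB; rewrite ?(negPf wy) // eC.
have yC : y \notin C.
  by apply/negP=> yC; have [|/eqP] := crS y x yC xD; rewrite 1?eq_sym ?(negPf wy) // eC.
(* If the corner [A :&: D] is only [x], all neighbours of [x] other than [w] and [y] lie in its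
   boundary; otherwise the boundary together with [x] separates the rest of the corner from
   [B :|: C]. *)
have bdAD : k <= #|~: ((A :&: D) :|: (B :|: C))|.+1.
  have [ADx|nADx] := boolP (A :&: D \subset [set x]).
    have : [set z in setT | e x z] \subset
           w |: (y |: ~: ((A :&: D) :|: (B :|: C))).
      apply/subsetP=> z; rewrite !inE /= => exz.
      case: (eqVneq z w) => //= zw; case: (eqVneq z y) => //= zy.
      rewrite !negb_or; apply/and3P; split.
      - apply/negP=> /andP[zA zD]; have := subsetP ADx z; rewrite !inE zA zD.
        by move=> /(_ isT) /eqP zx; rewrite zx eI in exz.
      - by apply/negP=> zB; have [_ /eqP] := crT x z xA zB exz; rewrite (negPf zy).
      apply/negP=> zC; have [|/eqP] := crS z x zC xD; first by rewrite eC.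
      by rewrite (negPf zw).
    move/subset_leq_card; rewrite !cardsU1 -/(deg_in e setT x); move: degx; clear; lia.
  have [z /andP[/setIP[zA zD] zx]] : exists z, (z \in A :&: D) && (z != x).
    by have/subsetPn[z zAD] := nADx; rewrite inE => zx; exists z; rewrite zAD.
  have : k <= #|~: ((A :&: D) :\ x :|: (B :|: C))|.
    apply: (kconn_bound ek (a := z) (b := y)); rewrite ?inE ?yB ?zA ?zD ?zx //.
      by move=> t /setD1P[_ /setIP[tA tD]] /setUP[/(dAB _ tA)|/dCD/(_ tD)].
    move=> a b /setD1P[/eqP ax /setIP[aA aD]] /setUP[bB|bC] eab.
      by case: ax; have [] := crT a b aA bB eab.
    by case: ax; have [|_ ->//] := crS b a bC aD; rewrite eC.
  move=> /leq_trans; apply; rewrite -add1n -(cards1 x).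
  apply: leq_trans (leq_card_setU _ _); apply: subset_leq_card.
  by apply/subsetP=> t; rewrite !inE; case: (t == x).
(* A common vertex of [B] and [C] would force at least [k] vertices into the boundary of [B :&: C],
   but submodularity leaves at most [k - 1] of them. *)
have BC z : z \in B -> z \in C -> False.
  move=> zB zC.
  have : k <= #|~: ((B :&: C) :|: (A :|: D))|.
    apply: (kconn_bound ek (a := z) (b := x)); rewrite ?inE ?zB ?zC ?xA //.
      by move=> t /setIP[tB tC] /setUP[/dAB/(_ tB)|/(dCD _ tC)].
    move=> a b /setIP[aB aC] /setUP[bA|bD] eab.
      have [|_ ay] := crT b a bA aB; first by rewrite eC.
      by rewrite -ay aC in yC.
    by have [aw _] := crS a b aC bD eab; rewrite -aw aB in wB.
  have : #|~: ((B :&: C) :|: (A :|: D))| + #|~: ((A :&: D) :|: (B :|: C))| <=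
         #|~: (A :|: B)| + #|~: (C :|: D)|.
    rewrite !card_indicator -!big_split; apply: leq_sum => t _; rewrite /= !inE.
    have:= disj_at t dAB; have := disj_at t dCD.
    by do 4! case: (t \in _).
  move: bdAD sS sT; clear; lia.
(* As [B :&: C] is empty, [C] consists of its parts in [A] and in the separator of the second cut.
   The final inequality is strict because [x] lies in [A :&: D]. *)
have : #|C| + #|~: ((A :&: D) :|: (B :|: C))| + #|A :&: D| <= #|A| + #|~: (A :|: B)|.
  rewrite !card_indicator -!big_split; apply: leq_sum => t _; rewrite /= !inE.
  have:= disj_at t dAB; have := disj_at t dCD; have := disj_at t BC.
  by do 4! case: (t \in _).
have : 0 < #|A :&: D| by apply/card_gt0P; exists x; rewrite inE xA.
move: bdAD sT; clear; lia.
Qed.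

End Cuts.

(** * The forest of non-removable edges *)

Section Forest.
Variables (V : finType) (k : nat) (e : rel V).
Hypotheses (eC : symmetric e) (eI : irreflexive e).
Implicit Types (A B C D W Q U : {set V}).

Lemma deg_inD1 W v w : v \in W -> deg_in e W w = e w v + deg_in e (W :\ v) w.
Proof.
move=> vW; rewrite /deg_in (cardsD1 v) inE vW; congr (_ + _).
by apply: eq_card => z; rewrite !inE andbA.
Qed.

Lemma deg_in_sub W W' w : W \subset W' -> deg_in e W w <= deg_in e W' w.
Proof.
move=> sW; apply: subset_leq_card; apply/subsetP=> z; rewrite !inE.
by case/andP=> /(subsetP sW)->.
Qed.

Lemma deg_in_gt0P W w : reflect (exists2 z, z \in W & e w z) (0 < deg_in e W w).
Proof.
apply: (iffP card_gt0P) => [[z]|[z zW ewz]]; last by exists z; rewrite inE zW.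
by rewrite inE => /andP[zW ewz]; exists z.
Qed.

Lemma deg_in_gt1 W w p : 1 < deg_in e W w -> exists2 z, z \in W & e w z && (z != p).
Proof.
case: (boolP (p \in W)) => pW; last first.
  move=> /ltnW /deg_in_gt0P[z zW ewz]; exists z => //; rewrite ewz.
  by apply: contraNneq pW => <-.
rewrite (deg_inD1 _ pW) => d1.
have /deg_in_gt0P[z] : 0 < deg_in e (W :\ p) w by case: (e w p) d1 => [|/ltnW].
by rewrite !inE => /andP[zp zW] ewz; exists z; rewrite ?ewz.
Qed.

(** At most [k - 1] neighbours of [q] lie in the separator and only [p] can lie in [A], so another
    one is in [B]. *)
Lemma cut_side_card p q A B :
  k < deg_in e setT q -> cut k e p q A B -> 1 < #|B|.
Proof.
move=> dq [dAB pA qB sT cr].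
have : [set z in setT | e q z] \subset p |: ((B :\ q) :|: ~: (A :|: B)).
  apply/subsetP=> z; rewrite !inE /= => eqz.
  have [zA|_] := boolP (z \in A).
    by have [|-> _] := cr z q zA qB; rewrite ?eqxx // eC.
  have [zq|_] := eqVneq z q; first by rewrite zq eI in eqz.
  by case: (z \in B); rewrite ?orbT.
move/subset_leq_card; rewrite cardsU1 -/(deg_in e setT q) => le1.
have := (leq_card_setU (B :\ q) (~: (A :|: B))).1; have := cardsD1 q B.
rewrite qB; move: dq sT le1; clear; lia.
Qed.

Hypothesis ek : kconn k e.

(** [cut_chain] read along the reversed walk: moving forward, it is the far sides that shrink. *)
Lemma cut_chain_forward p q t A B C D :
    e p q -> e q t -> p != t -> k < deg_in e setT q ->
    cut k e p q A B -> cut k e q t C D ->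
  #|D| < #|B|.
Proof.
move=> epq eqt pt dq cB cD.
by apply: (cut_chain eC eI ek _ _ _ dq (cut_sym eC cD) (cut_sym eC cB));
  rewrite 1?eC // eq_sym.
Qed.

(** Once around the cycle, the far sides would shrink strictly all the way back to the first one. *)
Lemma four_cycle_cuts a b c d :
    e a b -> e b c -> e c d -> e d a -> a != c -> b != d ->
    k < deg_in e setT a -> k < deg_in e setT b ->
    k < deg_in e setT c -> k < deg_in e setT d ->
    (exists A B, cut k e a b A B) -> (exists A B, cut k e b c A B) ->
    (exists A B, cut k e c d A B) -> (exists A B, cut k e d a A B) ->
  False.
Proof.
move=> ab bc cd da ac bd ka kb kc kd.
move=> [A1 [B1 c1]] [A2 [B2 c2]] [A3 [B3 c3]] [A4 [B4 c4]].
have ca : c != a by rewrite eq_sym.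
have db : d != b by rewrite eq_sym.
have := cut_chain_forward ab bc ac kb c1 c2; have := cut_chain_forward bc cd bd kc c2 c3.
have := cut_chain_forward cd da ca kd c3 c4; have := cut_chain_forward da ab db ka c4 c1.
clear; lia.
Qed.

Variable U : {set V}.
Hypothesis U_deg : forall u, u \in U -> k < deg_in e setT u.
Hypothesis U_cut : forall p q, p \in U -> q \in U -> e p q -> exists A B, cut k e p q A B.

(** Acyclicity of the non-removable edges: were all degrees in [W] at least two, a walk that never
    turns back could go on forever, while its far sides shrink strictly. *)
Lemma degenerate W : W \subset U -> W != set0 -> exists2 w, w \in W & deg_in e W w <= 1.
Proof.
move=> /subsetP WU /set0Pn[w0 w0W]; have [/exists_inP//|/exists_inPn d2] :=
  boolP [exists w in W, deg_in e W w <= 1].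
have d2' w p : w \in W -> exists2 z, z \in W & e w z && (z != p).
  by move=> /d2; rewrite -ltnNge; apply: deg_in_gt1.
suff no n p q A B : p \in W -> q \in W -> e p q -> cut k e p q A B -> #|B| < n -> False.
  have [q qW /andP[eq _]] := d2' w0 w0 w0W.
  have [A [B c]] := U_cut (WU _ w0W) (WU _ qW) eq.
  by case: (no #|B|.+1 _ _ _ _ w0W qW eq c (leqnn _)).
elim: n p q A B => // n IH p q A B pW qW epq c Bn.
have [t tW /andP[eqt tp]] := d2' q p qW.
have [C [D c']] := U_cut (WU _ qW) (WU _ tW) eqt.
apply: (IH q t C D) => //.
have := cut_chain_forward epq eqt _ (U_deg (WU _ qW)) c c'; rewrite eq_sym => /(_ tp).
move: Bn; clear; lia.
Qed.

(** If the vertex of low degree is [v] itself, remove it and avoid its neighbour [y] instead: a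
    low-degree vertex of the rest other than [y] is not adjacent to [v], so its degree is
    unchanged. *)
Lemma leaf_avoiding W v : W \subset U -> v \in W ->
  W = [set v] \/ exists w, [/\ w \in W, w != v & deg_in e W w <= 1].
Proof.
move: {2}#|W| (leqnn #|W|) => n; elim: n W v => [|n IH] W v.
  by rewrite leqn0 cards_eq0 => /eqP-> _; rewrite inE.
move=> Wn WU vW.
have [l lW dl] : exists2 w, w \in W & deg_in e W w <= 1.
  by apply: degenerate => //; apply/set0Pn; exists v.
have [lv|lv] := eqVneq l v; last by right; exists l.
subst l.
have [Wv|Wv] := eqVneq (W :\ v) set0.
  by left; rewrite -(setD1K vW) Wv setU0.
(* When [v] is isolated in [W], any other vertex can serve as [y]. *)
have [y yW vy] : exists2 y, y \in W :\ v & forall w, w \in W :\ v -> e v w -> w = y.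
  have [/existsP[y /andP[yW evy]]|/existsPn nvy] :=
      boolP [exists y, (y \in W :\ v) && e v y].
    exists y => // w wW evw; apply/eqP; apply: contraTT dl => wy.
    rewrite -ltnNge (deg_inD1 _ vW) eI add0n (deg_inD1 _ yW) evy ltnS.
    by apply/deg_in_gt0P; exists w; rewrite // in_setD1 wy.
  by have/set0Pn[y yW] := Wv; exists y => // w wW evw; have := nvy w; rewrite wW evw.
right; have := yW; rewrite in_setD1 => /andP[yv yW'].
have [||Wy|[w [wW wy dw]]] := IH (W :\ v) y _ _ yW.
- by have := cardsD1 v W; rewrite vW; move: Wn; clear; lia.
- by apply: subset_trans WU; apply: subD1set.
- exists y; split=> //; rewrite (deg_inD1 _ vW) Wy.
  have -> : deg_in e [set y] y = 0; last by case: (e y v).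
  by apply/eqP; rewrite -leqn0 leqNgt; apply/deg_in_gt0P => -[z /set1P->]; rewrite eI.
have := wW; rewrite in_setD1 => /andP[wv wW']; exists w; split=> //.
rewrite (deg_inD1 _ vW); case: (boolP (e w v)) => // ewv.
by case/eqP: wy; apply: vy; rewrite // eC.
Qed.

(* The walk that enters [Q] through [p], [q] has to traverse all of [Q] before it can
   leave through [t], and the far side of the cut shrinks at each of its steps. *)
Lemma far_side_card p q t Q A B :
    p \in U -> t \in U -> Q \subset U -> q \in Q -> p \notin Q -> t \notin Q -> p != t ->
    e p q -> 0 < deg_in e (t |: Q) q ->
    (forall w, w \in Q -> w != q -> 1 < deg_in e (t |: Q) w) ->
    cut k e p q A B ->
  #|Q| + 2 <= #|B|.
Proof.
move: {2}#|Q| (leqnn #|Q|) => n; elim: n p q Q A B => [|n IH] p q Q A B.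
  by rewrite leqn0 cards_eq0 => /eqP->; rewrite inE.
move=> Qn pU tU QU qQ pQ tQ pt epq dq dw c.
have qU := subsetP QU q qQ.
have tQU : t |: Q \subset U by rewrite subUset sub1set tU.
have tD : t \in (t |: Q) :\ q.
  by rewrite !inE eqxx andbT; apply: contraNneq tQ => ->.
have qtQ : q \in t |: Q by rewrite !inE qQ orbT.
(* Some vertex other than [t] has degree at most one in [t |: Q], and only [q] can be it; so the way
   on from [q] is forced. *)
have dq1 : deg_in e (t |: Q) q = 1.
  apply/eqP; rewrite eqn_leq dq andbT.
  have [E|[w [wtQ wt]]] := leaf_avoiding tQU (setU11 t Q).
    by move: qtQ; rewrite E inE => /eqP qt; rewrite -qt qQ in tQ.
  case: (eqVneq w q) => [-> //|wq]; rewrite leqNgt dw //.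
  by move: wtQ; rewrite !inE (negPf wt).
have [q2 q2Q eq2] : exists2 z, z \in t |: Q & e q z by apply/deg_in_gt0P; rewrite dq1.
have uniq2 w : w \in t |: Q -> e q w -> w = q2.
  move=> wQ eqw; apply/eqP; move/eqP: dq1; apply: contraLR => wq2.
  rewrite neq_ltn; apply/orP; right; rewrite (deg_inD1 _ q2Q) eq2 ltnS.
  by apply/deg_in_gt0P; exists w; rewrite // in_setD1 wq2.
have p2 : p != q2.
  by apply/eqP => pE; move: q2Q; rewrite -pE !inE (negPf pt) (negPf pQ).
have q2U := subsetP tQU _ q2Q.
have [C [D c']] := U_cut qU q2U eq2.
have lt := cut_chain_forward epq eq2 p2 (U_deg qU) c c'.
have DQ : (t |: Q) :\ q = t |: (Q :\ q).
  apply/setP => z; rewrite !inE; case: (eqVneq z t) => // ->.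
  by case: eqVneq tQ => // ->; rewrite qQ.
have dw' w : w \in Q -> w != q -> w != q2 -> 1 < deg_in e (t |: (Q :\ q)) w.
  move=> wQ wq wq2; have := dw w wQ wq; rewrite (deg_inD1 _ qtQ) DQ.
  case: (boolP (e w q)) => // ewq; case/eqP: wq2; apply: uniq2; last by rewrite eC.
  by rewrite !inE wQ orbT.
have cQ := cardsD1 q Q; rewrite qQ in cQ.
have tQq : t \notin Q :\ q by rewrite !inE (negPf tQ) andbF.
have tQqU : t |: (Q :\ q) \subset U by rewrite -DQ; apply: subset_trans tQU; apply: subD1set.
(* A walk that reaches [t] at once has exhausted [Q], since a leaf of [t |: (Q :\ q)] other than [t]
   would contradict the degree condition. Then [Q] is just [q], and [B] is larger than [D], which
   has at least two vertices. *)
have [q2t|q2t] := eqVneq q2 t.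
  have [E|[w [wQ wt]]] := leaf_avoiding tQqU (setU11 t _).
    have Q0 : Q :\ q = set0.
      apply/setP=> z; rewrite in_set0; apply/negP=> zQ.
      have : z \in t |: (Q :\ q) by rewrite in_setU zQ orbT.
      by rewrite E inE => /eqP zt; rewrite -zt zQ in tQq.
    have := cut_side_card (U_deg q2U) c'; move: lt; rewrite cQ Q0 cards0; clear; lia.
  move: wQ; rewrite !inE (negPf wt) /= => /andP[wq wQ].
  by rewrite leqNgt dw' // q2t.
have q2Q' : q2 \in Q.
  by move: q2Q; rewrite !inE (negPf q2t).
have q2q : q2 != q by apply: contraTneq eq2 => ->; rewrite eI.
have : #|Q :\ q| + 2 <= #|D|.
  apply: (IH q q2 (Q :\ q) C D) => //; rewrite ?inE ?eqxx ?q2q //.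
  - by move: Qn; rewrite cQ.
  - by apply: subset_trans QU; apply: subD1set.
  - by apply: contraNneq tQ => <-.
  - have := dw q2 q2Q' q2q; by rewrite (deg_inD1 _ qtQ) DQ eC eq2.
  by move=> w; rewrite in_setD1 => /andP[wq wQ] wq2; apply: dw'.
move: lt; rewrite cQ; clear; lia.
Qed.

End Forest.

(** * Graphs and matchings *)

(** A component of what is left after deleting [S], against the other remaining vertices, is a
    separation with separator [S]. Conversely, a side of a separation is closed under adjacency once
    the separator is deleted. *)
Lemma k_connectedP k (G : sgraph) : reflect (k_connected k G) (kconn k (@adj G)).
Proof.
apply: (iffP idP) => [Gk|[kG conn]].
  split=> [|S Sk x y]; first by case/andP: Gk.
  apply/negPn/negP=> nxy; pose A := [set val z | z in connect adj x].
  have AS z : z \in A -> z \notin S by case/imsetP=> w _ ->; exact: (valP w).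
  have : k <= #|~: (A :|: ~: (A :|: S))|.
    apply: (kconn_bound Gk (a := val x) (b := val y)).
    - by apply/imsetP; exists x => //; exact: connect0.
    - rewrite !inE negb_or (valP y) andbT; apply: contra nxy => /imsetP[z xz].
      by move/val_inj->.
    - by move=> z zA; rewrite !inE zA.
    move=> a b /imsetP[z xz ->]; rewrite !inE negb_or => /andP[bA bS] zb.
    case/negP: bA; apply/imsetP; exists (Sub b bS) => //.
    by apply: connect_trans xz _; apply: connect1.
  suff -> : ~: (A :|: ~: (A :|: S)) = S by rewrite leqNgt Sk.
  apply/setP=> z; rewrite !inE; have := AS z.
  by case: (z \in A) => [/(_ isT)/negPf->|_] //=; rewrite negbK.
apply/andP; split=> //; apply/forallP=> A; apply/forallP=> B; apply/implyP.
case/and4P=> /set0Pn[a aA] /set0Pn[b bB] /pred0P dAB /forall_inP nAB.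
rewrite leqNgt; apply/negP=> /conn ab.
have aT : a \notin ~: (A :|: B) by rewrite !inE aA.
have bT : b \notin ~: (A :|: B) by rewrite !inE bB orbT.
pose P := [pred z : del_vertices (~: (A :|: B)) | val z \in A].
have cl : closed adj P.
  apply: intro_closed => [|x y xy]; first exact/sym_connect_sym/adj_sym.
  rewrite !inE => xA; have := valP y; rewrite !inE negbK => /orP[//|yB].
  by have/forall_inP/(_ _ yB)/negP[] := nAB _ xA.
have := closed_connect cl (ab (Sub a aT) (Sub b bT)).
by rewrite !inE /= aA => bA; have := dAB b; rewrite /= -bA bB.
Qed.

Lemma min_degree_le (G : sgraph) (x : G) : min_degree G <= degree x.
Proof.
rewrite /min_degree; elim: (index_enum G) (mem_index_enum x) => // y s IH.
rewrite inE big_cons => /predU1P[->|/IH le_s]; first exact: geq_minl.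
exact: leq_trans (geq_minr _ _) le_s.
Qed.

Section Matchings.
Variable G : sgraph.
Implicit Types (M : {set {set G}}) (u v x y z : G).

Lemma edgesP (E : {set G}) :
  reflect (exists x y, adj x y /\ E = [set x; y]) (E \in edges G).
Proof.
apply: (iffP imsetP) => [[[x y] xy ->]|[x [y [xy ->]]]]; first by exists x, y; rewrite inE in xy.
by exists (x, y); rewrite ?inE.
Qed.

Lemma matching_edge M E : matching M -> E \in M -> exists x y, adj x y /\ E = [set x; y].
Proof. by case=> /subsetP ME _ /ME/edgesP. Qed.

Lemma matching_adj M x y : matching M -> [set x; y] \in M -> adj x y.
Proof.
move=> mM xyM; have [a [b [ab E]]] := matching_edge mM xyM.
have := set21 a b; have := set22 a b; rewrite -E !inE.
have nab : a != b by apply: contraTneq ab => ->; rewrite adj_irrefl.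
case/orP=> /eqP bE /orP[]/eqP aE; subst; rewrite ?eqxx // in nab.
by rewrite adj_sym.
Qed.

Lemma card_cover M : matching M -> #|cover M| = 2 * #|M|.
Proof.
move=> mM; have [_ /eqP<-] := mM; rewrite mulnC -sum_nat_const; apply: eq_bigr => E EM.
have [a [b [ab ->]]] := matching_edge mM EM.
by rewrite cards2; case: eqVneq ab => // ->; rewrite adj_irrefl.
Qed.

Lemma mem_cover M E x : E \in M -> x \in E -> x \in cover M.
Proof. by move=> EM xE; apply/bigcupP; exists E. Qed.

Lemma matching_uniq M E F x :
  matching M -> E \in M -> F \in M -> x \in E -> x \in F -> E = F.
Proof.
case=> _ /trivIsetP tM EM FM xE xF; apply/eqP; apply/negPn/negP=> /(tM _ _ EM FM).
by move=> /pred0P/(_ x); rewrite /= xE xF.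
Qed.

Lemma partner M x : matching M -> x \in cover M ->
  exists2 y, [set x; y] \in M & y \in cover M /\ forall z, [set x; z] \in M -> z = y.
Proof.
move=> mM /bigcupP[E EM xE]; have [a [b [ab EE]]] := matching_edge mM EM.
have [y xy] : exists y, E = [set x; y].
  move: xE; rewrite EE !inE => /orP[]/eqP->; [by exists b | by exists a; rewrite setUC].
exists y; first by rewrite -xy.
split=> [|z xzM]; first by apply: mem_cover EM _; rewrite xy set22.
have Exz := matching_uniq mM EM xzM xE (set21 x z).
have := set22 x z; rewrite -Exz xy !inE => /orP[/eqP zx|/eqP//].
by have := matching_adj mM xzM; rewrite zx adj_irrefl.
Qed.

Lemma matchingD1 M E : matching M -> matching (M :\ E).
Proof.
case=> ME tM; split; first exact: subset_trans (subD1set _ _) ME.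
exact: trivIsetS (subD1set _ _) tM.
Qed.

Lemma matchingU1 M u v : matching M -> u \notin cover M -> v \notin cover M -> adj u v ->
  [/\ matching ([set u; v] |: M), #|[set u; v] |: M| = #|M|.+1 &
      cover ([set u; v] |: M) = [set u; v] :|: cover M].
Proof.
move=> [ME /trivIsetP tM] uM vM uv.
have disj F : F \in M -> [disjoint [set u; v] & F].
  move=> FM; apply/pred0P=> x; rewrite /= !inE.
  by apply/negP=> /andP[/orP[]/eqP->] /(mem_cover FM); apply/negP.
have uvM : [set u; v] \notin M.
  by apply: contra uM => /mem_cover; apply; rewrite set21.
split; last by rewrite /cover bigcup_setU big_set1.
- split; first by rewrite subUset sub1set ME andbT; apply/edgesP; exists u, v.
  apply/trivIsetP=> E F /setU1P[->|EM] /setU1P[->|FM]; rewrite ?eqxx //.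
  + by move=> _; apply: disj.
  + by move=> _; rewrite disjoint_sym; apply: disj.
  exact: tM.
by rewrite cardsU1 uvM.
Qed.

Lemma del_edgesU1 M u v :
  del_edges_adj ([set u; v] |: M) =2 del_edge (del_edges_adj M) u v.
Proof.
move=> x y; rewrite /del_edges_adj /del_edge !inE negb_or -andbA.
by rewrite [_ && (_ \notin M)]andbC.
Qed.

Lemma del_edges_uncovered M u x : u \notin cover M -> del_edges_adj M u x = adj u x.
Proof.
move=> uM; rewrite /del_edges_adj; case: (boolP (_ \in M)) => [uxM|_]; rewrite ?andbT //.
by case/negP: uM; apply: mem_cover uxM (set21 _ _).
Qed.

End Matchings.

(** * Matchings of maximum size *)

Section DegIn.
Variables (V : finType) (e : rel V).
Implicit Types W : {set V}.

Lemma deg_in_card W w : deg_in e W w <= #|W|.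
Proof. by apply: subset_leq_card; apply/subsetP=> z; rewrite inE => /andP[]. Qed.

Lemma deg_inU W W' w : deg_in e (W :|: W') w <= deg_in e W w + deg_in e W' w.
Proof.
apply: leq_trans (leq_card_setU _ _).1; apply: subset_leq_card.
by apply/subsetP=> z; rewrite !inE andb_orl.
Qed.

Lemma deg_in_all W w : (forall z, e w z -> z \in W) -> deg_in e setT w = deg_in e W w.
Proof.
move=> eW; apply: eq_card => z; rewrite !inE /=.
by case: (boolP (e w z)) => [/eW->|]; rewrite ?andbF.
Qed.

End DegIn.

Section MaximumMatching.
Variables (G : sgraph) (k m : nat).
Local Notation d := (min_degree G).
Hypotheses (kd : k < d) (md : 2 * m <= d).
Implicit Types (M : {set {set G}}) (A B W : {set G}) (u v w x y z : G).

Definition removable M := [/\ matching M, kconn k (del_edges_adj M) & #|M| = m].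

Hypothesis no_larger :
  forall M, matching M -> kconn k (del_edges_adj M) -> #|M| <> m.+1.

(** * The forest on the uncovered vertices and the cuts at its leaves *)

Section FixedMatching.
Variable M : {set {set G}}.
Hypothesis remM : removable M.
Let mM : matching M. Proof. by case: remM. Qed.
Let hk : kconn k (del_edges_adj M). Proof. by case: remM. Qed.
Local Notation h := (del_edges_adj M).
Local Notation X := (cover M).
Local Notation U := (~: cover M).
Let hC : symmetric h := del_edges_sym M.
Let hI : irreflexive h := del_edges_irrefl M.

Lemma card_X : #|X| = 2 * m.
Proof. by rewrite card_cover //; case: remM => _ _ ->. Qed.

Lemma deg_U u : u \in U -> d <= deg_in h setT u.
Proof.
rewrite inE => uX; suff -> : deg_in h setT u = degree u by apply: min_degree_le.
by apply: eq_card => z; rewrite !inE del_edges_uncovered.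
Qed.

Let U_deg u : u \in U -> k < deg_in h setT u.
Proof. by move/deg_U; apply: leq_trans. Qed.

Lemma deg_X x : x \in X -> d <= (deg_in h setT x).+1.
Proof.
move=> xX; have [y xyM [yX y_uniq]] := partner mM xX.
apply: leq_trans (min_degree_le x) _; rewrite -add1n -(cards1 y).
apply: leq_trans (leq_card_setU _ _).1; apply: subset_leq_card; apply/subsetP=> z.
rewrite !inE /del_edges_adj => ->; case: (boolP ([set x; z] \in M)) => [/y_uniq->|].
  by rewrite eqxx.
by rewrite orbT.
Qed.

(** Otherwise [M] together with [uv] would be a removable matching of size [m.+1]. *)
Lemma U_cut u v : u \in U -> v \in U -> h u v -> exists A B, cut k h u v A B.
Proof.
rewrite !inE => uX vX huv; have uv : adj u v by rewrite -(del_edges_uncovered _ uX).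
have [kd'|//] := kconn_del_or_cut u v hC hk.
have [mM' cM' _] := matchingU1 mM uX vX uv.
case: (no_larger mM' _); last by rewrite cM'; case: remM => _ _ ->.
by apply: kconn_sub kd' => a b; rewrite del_edgesU1.
Qed.

Lemma deg_split w : deg_in h setT w <= deg_in h U w + deg_in h X w.
Proof. by apply: leq_trans (deg_inU _ _ _ _); rewrite setUC setUCr. Qed.

Let avoid := leaf_avoiding hC hI hk U_deg U_cut.

Lemma adj_far p q A B w z :
  cut k h p q A B -> w \in B -> w != q -> h w z -> z \in B :|: ~: (A :|: B).
Proof.
case=> dAB _ _ _ cr wB wq hwz; rewrite !inE.
have [zA|] := boolP (z \in A); last by case: (z \in B).
by have [|_ /eqP] := cr z w zA wB; rewrite ?(negPf wq) // hC.
Qed.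

(** If [B] were uncovered, the forest on [B] would have a leaf other than [v]; with at most one
    neighbour in [B] and all others in the separator, its degree would be at most [k]. *)
Lemma far_side_covered u v A B :
  u \in U -> v \in U -> h u v -> cut k h u v A B -> exists2 x, x \in B & x \in X.
Proof.
move=> uU vU huv c; have [/exists_inP//|/exists_inPn BU] := boolP [exists x in B, x \in X].
have BU' : B \subset U by apply/subsetP=> z zB; rewrite inE BU.
have [Bv|[w [wB wv dw]]] := avoid BU' (cut_r c).
  by have := cut_side_card hC hI (U_deg vU) c; rewrite Bv cards1.
have := U_deg (subsetP BU' _ wB).
rewrite (deg_in_all (fun z => adj_far c wB wv (z := z))).
have := deg_inU h B (~: (A :|: B)) w; have := deg_in_card h (~: (A :|: B)) w.
have := cut_small c; move: dw; clear; lia.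
Qed.

(** The degree of [u] is at least [d], hence at least [2 * m], but [U] contributes at most one and
    [X] at most [2 * m - 1]. Equality holds throughout, so no second vertex of [X] is missed. *)
Lemma missing_one u x : u \in U -> deg_in h U u <= 1 -> x \in X -> ~~ h u x ->
  [/\ d = 2 * m, deg_in h U u = 1 & forall y, y \in X -> y != x -> h u y].
Proof.
move=> uU du xX ux; have dX := deg_inD1 h u xX.
have := deg_in_card h (X :\ x) u; have := cardsD1 x X; rewrite xX card_X.
move: (deg_U uU) (deg_split u) dX md; rewrite (negPf ux) /= => h1 h2 h3 h4 h5 h6.
split; [by lia|by lia|] => y yX yx; apply/negPn/negP => uy.
have yXx : y \in X :\ x by rewrite !inE yx.
have := deg_inD1 h u yXx; have := deg_in_card h (X :\ x :\ y) u.
have := cardsD1 y (X :\ x); rewrite yXx (negPf uy); move: du h1 h2 h3 h4 h5 h6; clear; lia.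
Qed.

(** Only [uv] crosses the cut and [v] is uncovered, so [u] misses all of [B :&: X]; by [missing_one]
    this is a single vertex [x]. Degree counts in the forest then determine [d] and the
    separator. *)
Lemma leaf_cut u v A B :
    u \in U -> deg_in h U u <= 1 -> v \in U -> h u v -> cut k h u v A B ->
  [/\ d = 2 * m, d = k.+1 &
      exists x a, [/\ B :&: X = [set x], ~~ h u x, a \in A, a \in X :\ x &
                      ~: (A :|: B) = X :\ x :\ a]].
Proof.
move=> uU du vU huv c; have [dAB uA vB sT cr] := c.
have missB y : y \in B -> y \in X -> ~~ h u y.
  move=> yB yX; apply/negP=> /(cr _ _ uA yB)[_ yv].
  by move: vU; rewrite inE -yv yX.
have [x xB xX] := far_side_covered uU vU huv c.
have [d2m du1 hX] := missing_one uU du xX (missB x xB xX).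
have BX : B :&: X = [set x].
  apply/setP=> y; rewrite !inE; apply/andP/eqP => [[yB yX]|-> //].
  by apply/eqP; apply: contraLR (missB y yB yX) => yx; rewrite negbK hX.
have xBw w : w \in B -> w \notin U -> w = x.
  by move=> wB; rewrite inE negbK => wX; apply/set1P; rewrite -BX inE wB.
set T := ~: (A :|: B) in sT *.
have dB w : w \in B -> deg_in h B w <= deg_in h (B :&: U) w + 1.
  move=> wB; rewrite (deg_inD1 _ _ xB) addnC leq_add ?leq_b1 //.
  apply: deg_in_sub; apply/subsetP=> z; rewrite !inE => /andP[zx zB]; rewrite zB /=.
  by apply: contra zx => zX; rewrite (xBw z) // inE negbK.
have BU : B :&: U \subset U by apply: subsetIr.
have vBU : v \in B :&: U by rewrite inE vB.
(* A low-degree vertex [w] of [B :&: U] other than [v] has at most one neighbour there, besides [x]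
   and at most [k - 1] vertices of [T]. If [v] is alone, [u] takes the place of the forest
   neighbour. *)
have dk : d = k.+1.
  apply/eqP; rewrite eqn_leq kd andbT.
  have [E|[w [wBU wv dw]]] := avoid BU vBU.
    apply: leq_trans (deg_U vU) _.
    have vz z : h v z -> z \in u |: (x |: T).
      move=> hvz; rewrite !inE; case: (boolP (z \in A)) => [zA|_].
        by have [|-> _] := cr z v zA vB; rewrite ?eqxx // hC.
      case: (boolP (z \in B)) => [zB|_]; last by rewrite /= !orbT.
      case: (boolP (z \in U)) => [zU|/(xBw z zB)->]; last by rewrite eqxx /= orbT.
      have : z \in B :&: U by rewrite inE zB.
      by rewrite E inE => /eqP zv; rewrite zv hI in hvz.
    rewrite (deg_in_all vz); apply: leq_trans (deg_in_card _ _ _) _.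
    by rewrite !cardsU1; move: sT; case: (_ \notin _); case: (_ \notin _); clear; lia.
  have wB : w \in B by case/setIP: wBU.
  have wU : w \in U by case/setIP: wBU.
  apply: leq_trans (deg_U wU) _.
  rewrite (deg_in_all (fun z => adj_far c wB wv (z := z))) -/T.
  have := deg_inU h B T w; have := deg_in_card h T w; have := dB w wB.
  move: sT dw; clear; lia.
(* An uncovered [t] in the separator would be an exit for the walk entering [B] through [uv];
   [far_side_card] would then give [B] two vertices more than [B :&: U], whereas it has only [x] in
   addition. *)
have TU : forall t, t \in T -> t \in U -> False.
  move=> t tT tU; have tB : t \notin B by move: tT; rewrite !inE negb_or => /andP[].
  have tA : t \notin A by move: tT; rewrite !inE negb_or => /andP[].
  have xTt : #|x |: T :\ t| <= #|T|.
    by rewrite cardsU1 (cardsD1 t T) tT; case: (_ \notin _).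
  have nb w z : w \in B -> w != v \/ z != u -> h w z ->
      z \in (t |: B :&: U) :|: (x |: T :\ t).
    move=> wB wvzu hwz; rewrite !inE; case: (boolP (z \in A)) => [zA|_].
      have [|zu wv] := cr z w zA wB; first by rewrite hC.
      by case: wvzu => /eqP.
    case: (boolP (z \in B)) => [zB|_] /=; last by rewrite !andbT; case: (z == t); rewrite ?orbT.
    case: (boolP (z \in U)) => [|/(xBw z zB)->]; first by rewrite inE => ->; rewrite orbT.
    by rewrite eqxx !orbT.
  have cB : #|B| = #|B :&: U|.+1.
    rewrite (cardsD1 x) xB; congr (_.+1); apply: eq_card => z; rewrite !inE.
    case: (boolP (z \in B)) => zB; rewrite ?andbF // andbT; case: eqVneq => [->|zx].
      by rewrite xX.
    by apply/esym/negP=> zX; case/eqP: zx; apply: xBw; rewrite // inE negbK.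
  suff : #|B :&: U| + 2 <= #|B| by rewrite cB; clear; lia.
  apply: (far_side_card hC hI hk U_deg U_cut (p := u) (q := v) (t := t) (A := A)) => //.
  - by rewrite inE negb_and; apply/orP; left; apply/negP=> /(dAB _ uA).
  - by rewrite inE (negPf tB).
  - by apply: contraNneq tA => <-.
  - have vz z : h v z -> z \in u |: ((t |: B :&: U) :|: (x |: T :\ t)).
      move=> hvz; rewrite in_setU1; case: (eqVneq z u) => //= zu.
      by apply: nb hvz => //; right.
    have := U_deg vU; rewrite (deg_in_all vz) (deg_inD1 _ _ (setU11 _ _)).
    have : deg_in h ((u |: ((t |: B :&: U) :|: (x |: T :\ t))) :\ u) v <=
       deg_in h ((t |: B :&: U) :|: (x |: T :\ t)) v.
      by apply: deg_in_sub; rewrite subDset.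
    have := deg_inU h (t |: B :&: U) (x |: T :\ t) v.
    have := deg_in_card h (x |: T :\ t) v; move: xTt sT; case: (h v u); clear; lia.
  move=> w wBU wv; have wB : w \in B by case/setIP: wBU.
  have wU : w \in U by case/setIP: wBU.
  have wz z : h w z -> z \in (t |: B :&: U) :|: (x |: T :\ t).
    by move=> hwz; apply: nb hwz => //; left.
  have := U_deg wU; rewrite (deg_in_all wz).
  have := deg_inU h (t |: B :&: U) (x |: T :\ t) w.
  have := deg_in_card h (x |: T :\ t) w; move: xTt sT; clear; lia.
(* Moving [u] from [A] to the separator leaves no crossing edge, so [T] has exactly [k - 1]
   elements. *)
have cT : k <= #|T|.+1.
  have cA : 1 < #|A| := cut_side_card hC hI (U_deg uU) (cut_sym hC c).
  have [u' u'A u'u] : exists2 u', u' \in A & u' != u.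
    by have/card_gt0P[u'] : 0 < #|A :\ u| by [move: cA; rewrite (cardsD1 u) uA];
      rewrite !inE => /andP[]; exists u'.
  have : k <= #|~: ((A :\ u) :|: B)|.
    apply: (kconn_bound hk (a := u') (b := v)) => //; first by rewrite !inE u'u.
        by move=> z /setD1P[_ zA] /(dAB z zA).
    by move=> a b /setD1P[au aA] bB /(cr _ _ aA bB)[/eqP]; rewrite (negPf au).
  move/leq_trans; apply; rewrite -add1n -(cards1 u).
  apply: leq_trans (leq_card_setU _ _).1; apply: subset_leq_card; apply/subsetP=> z.
  by rewrite !inE; case: (z == u); case: (z \in A).
have TX : T \subset X :\ x.
  apply/subsetP=> z zT; rewrite !inE; apply/andP; split.
    by apply: contraTneq zT => ->; rewrite !inE xB orbT.
  by apply/negPn/negP=> zX; apply: (TU z zT); rewrite inE.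
have cX := cardsD1 x X; rewrite xX card_X in cX.
(* [X :\ x] has [2 * m - 1 = k] elements, one more than its subset [T]. *)
have [a aE] : exists a, (X :\ x) :\: T = [set a].
  apply/cards1P; rewrite cardsD (setIidPr TX); apply/eqP.
  move: cX cT sT dk; rewrite d2m; clear; lia.
have : a \in (X :\ x) :\: T by rewrite aE set11.
rewrite in_setD => /andP[aT aX]; split=> //; exists x, a.
split=> //; first exact: missB.
  move: aT; rewrite inE negbK in_setU => /orP[//|aB].
  have : a \in B :&: X by rewrite inE aB; case/setD1P: aX.
  by rewrite BX inE => /eqP ax; rewrite ax !inE eqxx in aX.
apply/setP=> z; rewrite in_setD1 -in_set1 -aE in_setD.
have := subsetP TX z; case: (z \in T) => [->//|_].
by case: (z \in X :\ x).
Qed.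

Lemma cut_uncovered_cases u v A B x a :
    ~: (A :|: B) = X :\ x :\ a -> cut k h u v A B ->
  forall w, w \in U -> w \in A \/ w \in B.
Proof.
move=> TE c w; rewrite inE => wX; apply/orP; rewrite -in_setU; apply/negPn/negP => wT.
have : w \in X :\ x :\ a by rewrite -TE inE.
by rewrite !inE (negPf wX) !andbF.
Qed.

(** Otherwise [A] contains a second leaf [w] of the forest. The far side of its own cut again meets
    [X] only in [x], while [u] and [v] are on the near side [A2]. A leaf [b] of the forest in [B]
    and [A2] then misses [x], so it is adjacent to [a], which gives a second edge across the first
    cut. *)
Lemma leaf_alone u v A B :
    u \in U -> deg_in h U u <= 1 -> v \in U -> h u v -> cut k h u v A B ->
  A :&: U = [set u].
Proof.
move=> uU du vU huv c; have [dAB uA vB _ cr] := c.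
have [d2m _ [x [a [BX ux aA aX TE]]]] := leaf_cut uU du vU huv c.
have xBX : x \in B :&: X by rewrite BX set11.
have [xB xX] := setIP xBX.
have [_ du1 hu] := missing_one uU du xX ux.
have uv_uniq z : z \in U -> h u z -> z = v.
  move=> zU huz; apply/eqP; apply: contraTT du => zv.
  rewrite -ltnNge (deg_inD1 _ _ vU) huv ltnS; apply/deg_in_gt0P.
  by exists z; rewrite // in_setD1 zv.
have uAU : u \in A :&: U by rewrite inE uA.
have [//|[w [wAU wu dw]]] := avoid (subsetIr _ _) uAU.
have [wA wU] := setIP wAU.
have UAB := cut_uncovered_cases TE c.
have wz z : z \in U -> h w z -> z \in A.
  move=> zU hwz; have [//|zB] := UAB z zU.
  by have [/eqP] := cr w z wA zB hwz; rewrite (negPf wu).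
have dw' : deg_in h U w <= 1.
  apply: leq_trans dw; apply: subset_leq_card; apply/subsetP=> z; rewrite inE => /andP[zU hwz].
  by rewrite !inE hwz wz //; move: zU; rewrite inE => ->.
have wx : ~~ h w x by apply/negP => /(cr _ _ wA xB)[/eqP]; rewrite (negPf wu).
have [_ dw1 hw] := missing_one wU dw' xX wx.
have [y yU hwy] : exists2 y, y \in U & h w y by apply/deg_in_gt0P; rewrite dw1.
have [A2 [B2 c2]] := U_cut wU yU hwy.
have [_ _ [x2 [a2 [BX2 wx2 aA2 aX2 TE2]]]] := leaf_cut wU dw' yU hwy c2.
have UAB2 := cut_uncovered_cases TE2 c2.
have [dAB2 wA2 yB2 _ cr2] := c2.
have : x2 \in B2 :&: X by rewrite BX2 set11.
case/setIP=> x2B x2X.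
have x2x : x2 = x by apply/eqP; apply: contraNT wx2 => /hw->.
subst x2.
have [a2x a2X] := setD1P aX2.
have a2w : a2 != w by apply: contraTneq a2X => ->; move: wU; rewrite inE.
have uA2 : u \in A2.
  have [//|uB2] := UAB2 u uU.
  have [|/eqP] := cr2 a2 u aA2 uB2; last by rewrite (negPf a2w).
  by rewrite hC hu.
have vA2 : v \in A2.
  have [//|vB2] := UAB2 v vU.
  by have [/eqP] := cr2 u v uA2 vB2 huv; rewrite eq_sym (negPf wu).
(* Every uncovered neighbour of a vertex of [B :&: A2 :&: U] lies in this set or is [u], so a
   low-degree vertex [b] other than [u] has low degree in the whole forest. *)
have WU : u |: (B :&: A2 :&: U) \subset U by rewrite subUset sub1set uU subsetIr.
have [E|[b [bW bu db]]] := avoid WU (setU11 u _).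
  have : v \in u |: (B :&: A2 :&: U) by rewrite in_setU !in_setI vB vA2 vU orbT.
  by rewrite E inE => /eqP vu; rewrite vu hI in huv.
move: bW; rewrite in_setU1 (negPf bu) => /setIP[/setIP[bB bA2] bU].
have bw : b != w by apply/eqP=> bw; apply: (dAB w); rewrite // -bw.
have db' : deg_in h U b <= 1.
  apply: leq_trans db; apply: subset_leq_card; apply/subsetP=> z; rewrite inE => /andP[zU hbz].
  rewrite inE hbz andbT in_setU1; have [zA|zB] := UAB z zU.
    by have [|-> _] := cr z b zA bB; rewrite ?eqxx // hC.
  apply/orP; right; rewrite !in_setI zB zU andbT /=.
  by have [//|zB2] := UAB2 z zU; have [/eqP] := cr2 b z bA2 zB2 hbz; rewrite (negPf bw).
have bx : ~~ h b x by apply/negP=> /(cr2 _ _ bA2 x2B)[/eqP]; rewrite (negPf bw).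
have [_ _ hb] := missing_one bU db' xX bx.
have [ax aX'] := setD1P aX.
have [|au _] := cr a b aA bB; first by rewrite hC hb.
by move: uU; rewrite inE -au aX'.
Qed.

(** Stated with adjacency in [G] rather than with [M] deleted, so that the data of two matchings can
    be compared after an exchange. *)
Definition leaf_data u x y :=
  [/\ [set x; y] \in M, ~~ adj u x, forall z, z \in X -> z != x -> adj u z,
      forall w, w \in U -> w != u -> ~~ adj w y &
      forall z, z \in X -> z != x -> z != y -> adj y z].

(** The vertex [a] of [leaf_cut] serves as [y]. After deletion of [M] its neighbours are among [u]
    and [X :\ x :\ a], that is [d - 1] vertices, so all of these are neighbours and its partner in
    [M] can only be [x]. *)
Lemma leaf_structure u v :
    u \in U -> deg_in h U u <= 1 -> v \in U -> h u v ->
  [/\ d = 2 * m, d = k.+1 & exists x y, leaf_data u x y].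
Proof.
move=> uU du vU huv; have [A [B c]] := U_cut uU vU huv.
have [d2m dk [x [a [BX ux aA aX TE]]]] := leaf_cut uU du vU huv c.
have AU := leaf_alone uU du vU huv c; have UAB := cut_uncovered_cases TE c.
have [dAB uA vB _ cr] := c; have [ax aX'] := setD1P aX.
have : x \in B :&: X by rewrite BX set11.
case/setIP=> xB xX; have [_ du1 hu] := missing_one uU du xX ux.
have au : a != u by apply: contraTneq aX' => ->; move: uU; rewrite inE.
have uX : u \notin X by move: uU; rewrite inE.
split=> //; exists x, a.
have az z : h a z -> z \in u |: (X :\ x :\ a).
  move=> haz; have zB : z \notin B.
    by apply/negP=> zB; have [/eqP] := cr a z aA zB haz; rewrite (negPf au).
  rewrite in_setU1; have [zX|zX] := boolP (z \in X).
    rewrite !in_setD1 zX andbT.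
    have -> : z != a by apply: contraTneq haz => ->; rewrite hI.
    have -> : z != x by apply: contraNneq zB => ->.
    by rewrite orbT.
  have zU : z \in U by rewrite inE.
  have [zA|] := UAB z zU; last by rewrite (negPf zB).
  by have : z \in A :&: U by [rewrite inE zA]; rewrite AU inE => ->.
have cX := card_X; rewrite (cardsD1 x) xX (cardsD1 a (X :\ x)) aX in cX.
have full z : z \in X :\ x :\ a -> h a z.
  move=> zT; apply/negPn/negP=> nz; have := deg_X aX'; rewrite (deg_in_all az).
  rewrite (deg_inD1 _ _ (setU1r u zT)) (negPf nz) add0n.
  have := deg_in_card h ((u |: (X :\ x :\ a)) :\ z) a.
  have := cardsD1 z (u |: (X :\ x :\ a)); rewrite setU1r // cardsU1.
  move: cX d2m; case: (u \notin _); clear; lia.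
split.
- have [y ayM [yX _]] := partner mM aX'.
  suff -> : x = y by rewrite setUC.
  apply/eqP; rewrite eq_sym; apply: contraT => yx.
  have : h a y.
    apply: full; rewrite !in_setD1 yx yX !andbT.
    by apply: contraTneq (matching_adj mM ayM) => ->; rewrite adj_irrefl.
  by rewrite /del_edges_adj ayM andbF.
- by move: ux; rewrite del_edges_uncovered.
- by move=> z zX zx; rewrite -(del_edges_uncovered z uX); apply: hu.
- move=> w wU wu; have [wA|wB] := UAB w wU.
    by have : w \in A :&: U by [rewrite inE wA]; rewrite AU inE (negPf wu).
  have wX : w \notin X by move: wU; rewrite inE.
  rewrite -(del_edges_uncovered a wX) hC; apply/negP=> /(cr _ _ aA wB)[/eqP].
  by rewrite (negPf au).
move=> z zX zx za; have : h a z by apply: full; rewrite !in_setD1 za zx.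
by case/andP.
Qed.

Definition end_data u b x y := leaf_data u x y /\ leaf_data b y x.

(** One leaf [u] yields [x] and [y]. A second leaf [b] misses [y], hence no other covered vertex,
    and uniqueness of partners gives it the same edge with the ends exchanged. *)
Lemma ends_exist p q :
    p \in U -> q \in U -> adj p q ->
  [/\ d = 2 * m, d = k.+1 & exists u b x y,
      [/\ u \in U, b \in U, u != b, deg_in h U u = 1 /\ deg_in h U b = 1 & end_data u b x y]].
Proof.
move=> pU qU pq.
have hU w z : w \in U -> h w z = adj w z by rewrite inE => /del_edges_uncovered->.
(* Isolated vertices of the forest are discarded, so that the leaf found in [W] has a neighbour in
   [U]. *)
pose W := [set w in U | 0 < deg_in h U w].
have WU : W \subset U by apply/subsetP=> w; rewrite inE => /andP[].
have W0 : W != set0.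
  apply/set0Pn; exists p; rewrite inE pU; apply/deg_in_gt0P; exists q => //.
  by rewrite hU.
have [u uW du] := degenerate hC hI hk U_deg U_cut WU W0.
have uU := subsetP WU _ uW.
have du' : deg_in h U u <= 1.
  apply: leq_trans du; apply: subset_leq_card; apply/subsetP=> z; rewrite inE => /andP[zU hz].
  rewrite !inE hz andbT -in_setC zU; apply/deg_in_gt0P; exists u => //.
  by rewrite hC.
have [v vU huv] : exists2 v, v \in U & h u v.
  by move: uW; rewrite inE => /andP[_ /deg_in_gt0P].
have [d2m dk [x [y ud]]] := leaf_structure uU du' vU huv.
split=> //; have [xyM ux uz wy yz] := ud.
have yX : y \in X := mem_cover xyM (set22 _ _).
have xX : x \in X := mem_cover xyM (set21 _ _).
have du1 : deg_in h U u = 1.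
  by have [] := missing_one uU du' xX; rewrite ?hU.
have [E|[b [bU bu db]]] := avoid (subxx _) uU.
  by move: vU; rewrite E inE => /eqP vu; rewrite vu hI in huv.
have [_ db1 _] : [/\ d = 2 * m, deg_in h U b = 1 & forall z, z \in X -> z != y -> h b z].
  by apply: missing_one => //; rewrite hU // wy.
have [c cU hbc] : exists2 c, c \in U & h b c by apply/deg_in_gt0P; rewrite db1.
have [_ _ [x' [y' bd]]] := leaf_structure bU db cU hbc.
have [xyM' bx bz wy' yz'] := bd.
have x'X : x' \in X := mem_cover xyM' (set21 _ _).
have x'y : x' = y.
  by apply/eqP; apply: contraNT (wy b bU bu) => x'y; apply: bz => //; rewrite eq_sym.
subst x'; have [z _ [_ zu]] := partner mM x'X.
have y'x : y' = x by rewrite (zu _ xyM') (zu x) // setUC.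
by subst y'; exists u, b, x, y; split; rewrite // eq_sym.
Qed.

End FixedMatching.

(** * Exchanging an edge of the matching *)

Lemma removableU1 M c y :
    matching M -> kconn k (del_edge (del_edges_adj M) c y) -> #|M|.+1 = m ->
    c \notin cover M -> y \notin cover M -> adj c y ->
  removable ([set c; y] |: M).
Proof.
move=> mM kd' cM cX yX cy; have [mM' cM' _] := matchingU1 mM cX yX cy.
by split; rewrite ?cM' //; apply: kconn_sub kd' => p q; rewrite del_edgesU1.
Qed.

(** With [zz'] restored, the four vertices of the cycle [a], [z], [b], [z'] are uncovered and have
    degree above [k]; by [four_cycle_cuts] some edge of it has no cut, so it can be deleted. *)
Lemma swap M a b z z' :
    removable M -> [set z; z'] \in M -> a \notin cover M -> b \notin cover M -> a != b ->
    adj a z -> adj a z' -> adj b z -> adj b z' ->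
  exists c y, [/\ c = a \/ c = b, y = z \/ y = z' &
                  removable ([set c; y] |: (M :\ [set z; z']))].
Proof.
move=> [mM hk cM] EM aX bX ab az az' bz bz'.
set N := M :\ [set z; z'].
have mN : matching N := matchingD1 _ mM.
have cN : #|N|.+1 = m by rewrite -cM (cardsD1 [set z; z'] M) EM.
have coverN : cover N = cover M :\: [set z; z'] := coverD1 (proj2 mM) EM.
have aN : a \notin cover N by rewrite coverN inE negb_and aX orbT.
have bN : b \notin cover N by rewrite coverN inE negb_and bX orbT.
have zN : z \notin cover N by rewrite coverN !inE eqxx.
have z'N : z' \notin cover N by rewrite coverN !inE eqxx orbT.
have nk : kconn k (del_edges_adj N).
  apply: kconn_sub hk => p q /andP[pq pqM]; rewrite /del_edges_adj pq.
  by apply: contra pqM; apply: (subsetP (subD1set _ _)).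
have degN w : w \notin cover N -> k < deg_in (del_edges_adj N) setT w.
  move=> wN; suff -> : deg_in (del_edges_adj N) setT w = degree w.
    exact: leq_trans kd (min_degree_le w).
  by apply: eq_card => t; rewrite !inE del_edges_uncovered.
have zz' : z != z'.
  by apply: contraTneq (matching_adj mM EM) => ->; rewrite adj_irrefl.
have try c y : c \notin cover N -> y \notin cover N -> adj c y ->
    removable ([set c; y] |: N) \/ exists A B, cut k (del_edges_adj N) c y A B.
  move=> cN' yN cy.
  have [kd'|] := kconn_del_or_cut c y (del_edges_sym N) nk; last by right.
  by left; apply: removableU1.
have [r|c1] := try a z aN zN az; first by exists a, z; split; auto.
have [r|c2] := try z b zN bN (etrans (adj_sym _ _) bz).
  by exists b, z; split; auto; rewrite [[set b; z]]setUC.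
have [r|c3] := try b z' bN z'N bz'; first by exists b, z'; split; auto.
have [r|c4] := try z' a z'N aN (etrans (adj_sym _ _) az').
  by exists a, z'; split; auto; rewrite [[set a; z']]setUC.
case: (four_cycle_cuts (del_edges_sym N) (del_edges_irrefl N) nk
  _ _ _ _ ab zz' _ _ _ _ c1 c2 c3 c4);
  by rewrite ?del_edges_uncovered ?degN // adj_sym.
Qed.

Lemma swap_uncovered M c y z z' w :
    matching M -> [set z; z'] \in M -> c \notin cover M -> y = z \/ y = z' -> adj c y ->
  (w \in ~: cover ([set c; y] |: (M :\ [set z; z']))) =
  [&& w != c, w != y & (w \in [set z; z']) || (w \notin cover M)].
Proof.
move=> mM EM cX yz cy; have [||_ _ ->] := matchingU1 (matchingD1 [set z; z'] mM) _ _ cy.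
- by rewrite (coverD1 (proj2 mM) EM) inE negb_and cX orbT.
- by rewrite (coverD1 (proj2 mM) EM) !inE; case: yz => ->; rewrite eqxx ?orbT.
by rewrite (coverD1 (proj2 mM) EM) !inE; case: (w == c); case: (w == y);
  case: (w == z); case: (w == z'); case: (w \in cover M).
Qed.

Lemma end_data_missing M u b x y w :
    end_data M u b x y -> u != b -> w \in ~: cover M -> ~~ adj w x \/ ~~ adj w y.
Proof.
move=> [[_ ux _ uy _] [_ by_ _ bx _]] ub wU.
by have [->|wu] := eqVneq w u; [left | right; apply: uy].
Qed.

(* After the swap, the ends of the new uncovered path would have to be non-adjacent to
   one of [x], [y] or to one of [u], [z]. *)
Lemma swap_end M u b x y z z' :
    removable M -> u \in ~: cover M -> b \in ~: cover M -> u != b -> end_data M u b x y ->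
    [set z; z'] \in M -> z \notin [set x; y] -> z' \notin [set x; y] ->
  ~ removable ([set u; z] |: (M :\ [set z; z'])).
Proof.
move=> remM uU bU ub ud EM zxy z'xy remM1; have [mM _ _] := remM.
have [[xyM ux uX uy yX] [_ nby bX bx xX]] := ud.
move: (uU) (bU); rewrite !inE => uC bC.
move: zxy z'xy; rewrite !inE !negb_or => /andP[zx zy] /andP[z'x z'y].
have zC : z \in cover M := mem_cover EM (set21 _ _).
have z'C : z' \in cover M := mem_cover EM (set22 _ _).
have xC : x \in cover M := mem_cover xyM (set21 _ _).
have yC : y \in cover M := mem_cover xyM (set22 _ _).
have uz : adj u z by apply: uX.
have U1 w := swap_uncovered w mM EM uC (or_introl erefl) uz.
set M1 := [set u; z] |: _ in remM1 U1.
have bU1 : b \in ~: cover M1.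
  rewrite U1 eq_sym ub bC orbT andbT /=.
  by apply: contraNneq bC => ->.
have zz' : z' != z.
  by apply: contraTneq (matching_adj mM EM) => ->; rewrite adj_irrefl.
have z'U1 : z' \in ~: cover M1.
  by rewrite U1 zz' !inE eqxx orbT andbT /=; apply: contraNneq uC => <-.
have bz' : adj b z' by apply: bX.
have [_ _ [u1 [b1 [x1 [y1 [u1U b1U u1b1 _ ud1]]]]]] := ends_exist remM1 bU1 z'U1 bz'.
have [[x1y1M1 u1x1 u1X u1y1 _] [_ b1y1 b1X b1x1 _]] := ud1.
have yU1 : y \in cover M1.
  apply: contraT; rewrite -in_setC U1 yC orbF => /and3P[_ _].
  by rewrite !inE eq_sym (negPf zy) eq_sym (negPf z'y).
have nb := end_data_missing ud1 u1b1 bU1.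
have nz' := end_data_missing ud1 u1b1 z'U1.
(* First case: [x1] and [y1] are [u] and [z]. As [b] misses [y], a covered vertex outside this pair,
   it is neither [u1] nor [b1] and so misses both [x1] and [y1]; yet it is adjacent to [z]. *)
have := x1y1M1; rewrite in_setU1 in_setD1 => /orP[/eqP E|/andP[_ x1y1M]].
  have x1uz : x1 \in [set u; z] by rewrite -E set21.
  have y1uz : y1 \in [set u; z] by rewrite -E set22.
  have yuz : y \notin [set u; z].
    by rewrite !inE negb_or [y == z]eq_sym zy andbT; apply: contraNneq uC => <-.
  have [bu1|bu1] := eqVneq b u1.
    by case/negP: nby; rewrite bu1; apply: u1X => //; apply: contraNneq yuz => ->.
  have [bb1|bb1] := eqVneq b b1.
    by case/negP: nby; rewrite bb1; apply: b1X => //; apply: contraNneq yuz => ->.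
  have bz : adj b z by apply: bX.
  have : z \in [set x1; y1] by rewrite E set22.
  rewrite !inE => /orP[]/eqP zE.
    by have := b1x1 b bU1 bb1; rewrite -zE bz.
  by have := u1y1 b bU1 bu1; rewrite -zE bz.
(* Second case: an old edge. It contains a vertex missed by [b], which can only be [y], so it is
   [xy]; but [z'] is adjacent to both [x] and [y]. *)
have x1C : x1 \in cover M := mem_cover x1y1M (set21 _ _).
have y1C : y1 \in cover M := mem_cover x1y1M (set22 _ _).
have Exy : [set x1; y1] = [set x; y].
  have y_in : y \in [set x1; y1].
    rewrite !inE; case: nb => nb; apply/orP; [left|right]; rewrite eq_sym;
      by apply: contraNT nb => ne; apply: bX.
  exact: matching_uniq mM x1y1M xyM y_in (set22 _ _).
have z'x1y1 : z' != x1 /\ z' != y1.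
  have z'n : z' \notin [set x1; y1] by rewrite Exy !inE negb_or z'x.
  by move: z'n; rewrite !inE negb_or => /andP.
have adjz' w : w \in [set x1; y1] -> adj z' w.
  by rewrite Exy !inE adj_sym => /orP[]/eqP->; [apply: xX | apply: yX].
by case: nz'; rewrite adjz' // ?set21 ?set22.
Qed.

(** A second edge [zz'] of [M] can be exchanged by [swap]; each of the four possible new edges is
    refuted by [swap_end], up to renaming [u] and [b], or [z] and [z']. *)
Lemma no_uncovered_edge M p q :
  1 < m -> removable M -> p \in ~: cover M -> q \in ~: cover M -> ~~ adj p q.
Proof.
move=> m1 remM pU qU; apply/negP=> pq; have [mM _ cM] := remM.
have [_ _ [u [b [x [y [uU bU ub _ ud]]]]]] := ends_exist remM pU qU pq.
have [ld1 ld2] := ud; have [xyM _ uX _ _] := ld1; have [yxM _ bX _ _] := ld2.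
have [E] : exists E, E \in M :\ [set x; y].
  by apply/card_gt0P; move: m1; rewrite -cM (cardsD1 [set x; y] M) xyM.
rewrite in_setD1 => /andP[Exy EM]; have [z [z' [zz' EE]]] := matching_edge mM EM.
subst E; have nxy w : w \in [set z; z'] -> w \notin [set x; y].
  move=> wE; apply/negP=> wxy; case/eqP: Exy; exact: matching_uniq mM EM xyM wE wxy.
have nzx := nxy z (set21 _ _); have nz'x := nxy z' (set22 _ _).
have zC : z \in cover M := mem_cover EM (set21 _ _).
have z'C : z' \in cover M := mem_cover EM (set22 _ _).
have Uxy w : w \in cover M -> w \notin [set x; y] -> adj u w /\ adj b w.
  by move=> wC; rewrite !inE negb_or => /andP[wx wy]; split; [apply: uX|apply: bX].
have [[uz bz] [uz' bz']] := (Uxy z zC nzx, Uxy z' z'C nz'x).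
have [uC bC] : u \notin cover M /\ b \notin cover M by rewrite -!in_setC.
have yxE : [set y; x] = [set x; y] by rewrite setUC.
have bu : b != u by rewrite eq_sym.
have [c [w [cE wE r]]] := swap remM EM uC bC ub uz uz' bz bz'.
have EM' : [set z'; z] \in M by rewrite setUC.
have EE' : [set z'; z] = [set z; z'] by rewrite setUC.
case: cE wE r => -> [] ->.
- exact: (swap_end remM uU bU ub ud EM nzx nz'x).
- rewrite -EE'; exact: (swap_end remM uU bU ub ud EM' nz'x nzx).
- by apply: (swap_end remM bU uU bu (conj ld2 ld1) EM); rewrite yxE.
by rewrite -EE'; apply: (swap_end remM bU uU bu (conj ld2 ld1) EM'); rewrite yxE.
Qed.

(** If [U] were independent, [missing_one] would make each uncovered vertex adjacent to all of [X].
    An exchange then creates an edge between uncovered vertices, and the data from [ends_exist]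
    contradict [end_data_missing]. *)
Lemma uncovered_edge M :
    removable M -> 1 < #|~: cover M| ->
  exists p q, [/\ p \in ~: cover M, q \in ~: cover M & adj p q].
Proof.
move=> remM /card_gt1P[u [v [uU vU uv]]]; have [mM hk cM] := remM.
have [/existsP[p /existsP[q /and3P[pU qU pq]]]|/existsPn nex] :=
  boolP [exists p, exists q, [&& p \in ~: cover M, q \in ~: cover M & adj p q]].
  by exists p, q.
have indep p q : p \in ~: cover M -> q \in ~: cover M -> ~~ adj p q.
  by move=> pU qU; have/existsPn/(_ q) := nex p; rewrite pU qU.
have dU w : w \in ~: cover M -> deg_in (del_edges_adj M) (~: cover M) w = 0.
  move=> wU; apply/eqP; rewrite -leqn0 leqNgt; apply/deg_in_gt0P => -[z zU].
  by rewrite del_edges_uncovered ?(negPf (indep _ _ wU zU)) // -in_setC.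
have wX w z : w \in ~: cover M -> z \in cover M -> adj w z.
  move=> wU zX; apply/negPn/negP=> nwz.
  have := missing_one remM wU _ zX; rewrite dU // => /(_ isT)[] //.
  by rewrite del_edges_uncovered // -in_setC.
have M0 : 0 < #|M|.
  rewrite lt0n; apply/eqP=> M0; have := deg_U uU; have := deg_split M u.
  have := deg_in_card (del_edges_adj M) (cover M) u.
  rewrite dU // card_X // -cM M0; move: kd; clear; lia.
have/card_gt0P[E EM] := M0; have [x [x' [xx' EE]]] := matching_edge mM EM; subst E.
have one u' v' y y' : u' \in ~: cover M -> v' \in ~: cover M -> u' != v' -> [set y; y'] \in M ->
    ~ removable ([set u'; y] |: (M :\ [set y; y'])).
  move=> uU' vU' uv' EM' remM1.
  have yC : y \in cover M := mem_cover EM' (set21 _ _).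
  have y'C : y' \in cover M := mem_cover EM' (set22 _ _).
  have uC : u' \notin cover M by rewrite -in_setC.
  have vC : v' \notin cover M by rewrite -in_setC.
  have U1 w := swap_uncovered w mM EM' uC (or_introl erefl) (wX _ _ uU' yC).
  have yy' : adj y y' := matching_adj mM EM'.
  set M1 := [set u'; y] |: _ in remM1 U1.
  have vU1 : v' \in ~: cover M1.
    by rewrite U1 eq_sym uv' vC orbT andbT; apply: contraNneq vC => ->.
  have y'U1 : y' \in ~: cover M1.
    rewrite U1 !inE eqxx orbT andbT; apply/andP; split; first by apply: contraNneq uC => <-.
    by apply: contraTneq yy' => ->; rewrite adj_irrefl.
  have [_ _ [u1 [b1 [x1 [y1 [_ _ ub1 _ ud1]]]]]] :=
    ends_exist remM1 vU1 y'U1 (wX _ _ vU' y'C).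
  have nv := end_data_missing ud1 ub1 vU1; have ny := end_data_missing ud1 ub1 y'U1.
  have [[xyM1 _ _ _ _] _] := ud1.
  (* Both ends of the new edge are adjacent to [y'], and both ends of an old one are adjacent to
     [v']. *)
  have := xyM1; rewrite in_setU1 in_setD1 => /orP[/eqP E|/andP[_ xyM]].
    have ay w : w \in [set x1; y1] -> adj y' w.
      by rewrite E !inE adj_sym => /orP[]/eqP-> //; apply: wX.
    by case: ny; rewrite ay // ?set21 ?set22.
  by case: nv; rewrite wX // (mem_cover xyM) // ?set21 ?set22.
have xC : x \in cover M := mem_cover EM (set21 _ _).
have x'C : x' \in cover M := mem_cover EM (set22 _ _).
have [uC vC] : u \notin cover M /\ v \notin cover M by rewrite -!in_setC.
have vu : v != u by rewrite eq_sym.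
have EM' : [set x'; x] \in M by rewrite setUC.
have EE' : [set x'; x] = [set x; x'] by rewrite setUC.
have [c [w [cE wE r]]] := swap remM EM uC vC uv (wX _ _ uU xC) (wX _ _ uU x'C)
  (wX _ _ vU xC) (wX _ _ vU x'C).
case: cE wE r => -> [] -> r.
- by case: (one u v x x').
- by case: (one u v x' x); rewrite ?EE'.
- by case: (one v u x x').
by case: (one v u x' x); rewrite ?EE'.
Qed.

End MaximumMatching.

(** * The exceptional graphs *)

Section ForestPath.
Variables (V : finType) (k : nat) (e : rel V).
Hypotheses (eC : symmetric e) (eI : irreflexive e) (ek : kconn k e).
Variable U : {set V}.
Hypothesis U_deg : forall u, u \in U -> k < deg_in e setT u.
Hypothesis U_cut : forall p q, p \in U -> q \in U -> e p q -> exists A B, cut k e p q A B.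

(** Unless [Q] is only [b], [leaf_avoiding] gives a low-degree vertex other than [b], which must be
    [q]. After its removal its only neighbour is the next starting point. The last clause excludes
    chords. *)
Lemma forest_path (Q : {set V}) q b :
    Q \subset U -> q \in Q -> b \in Q -> (q != b -> 0 < deg_in e Q q) ->
    (forall w, w \in Q -> w != q -> w != b -> 1 < deg_in e Q w) ->
  exists s, [/\ uniq (q :: s), q :: s =i Q, last q s = b, path e q s &
    forall z w, z \in Q -> w \in Q -> e z w ->
      index w (q :: s) = (index z (q :: s)).+1 \/ index z (q :: s) = (index w (q :: s)).+1].
Proof.
move: {2}#|Q| (leqnn #|Q|) => n; elim: n Q q => [|n IH] Q q.
  by rewrite leqn0 cards_eq0 => /eqP->; rewrite inE.
move=> Qn QU qQ bQ dq dw.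
have [E|[w [wQ wb dwQ]]] := leaf_avoiding eC eI ek U_deg U_cut QU bQ.
  have qb : q = b by apply/set1P; rewrite -E.
  subst b; exists [::]; split=> // [z|z w]; first by rewrite E !inE.
  by rewrite E !inE => /eqP-> /eqP->; rewrite eI.
have wq : w = q.
  by apply/eqP; apply: contraTT dwQ => wq; rewrite -ltnNge dw.
subst w.
have [q2 q2Q eq2] : exists2 z, z \in Q & e q z by apply/deg_in_gt0P; apply: dq.
have q2q : q2 != q by apply: contraTneq eq2 => ->; rewrite eI.
have q2_uniq z : z \in Q -> e q z -> z = q2.
  move=> zQ eqz; apply/eqP; apply: contraTT dwQ => zq2.
  rewrite -ltnNge (deg_inD1 _ _ q2Q) eq2 ltnS; apply/deg_in_gt0P.
  by exists z; rewrite // in_setD1 zq2.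
have q2Q' : q2 \in Q :\ q by rewrite in_setD1 q2q.
have [|||||s [us sQ ls ps cs]] := IH (Q :\ q) q2 _ _ q2Q'.
- by move: Qn; rewrite (cardsD1 q) qQ.
- exact: subset_trans (subD1set _ _) QU.
- by rewrite in_setD1 eq_sym wb.
- by move=> q2b; have := dw q2 q2Q q2q q2b; rewrite (deg_inD1 _ _ qQ) eC eq2.
- move=> w; rewrite in_setD1 => /andP[wq wQ'] wq2 wb'; have := dw w wQ' wq wb'.
  rewrite (deg_inD1 _ _ qQ); case: (boolP (e w q)) => // ewq.
  by case/eqP: wq2; apply: q2_uniq; rewrite // eC.
exists (q2 :: s); split.
- by rewrite cons_uniq us andbT sQ in_setD1 eqxx.
- by move=> z; rewrite in_cons sQ in_setD1; case: eqVneq => // ->.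
- exact: ls.
- by rewrite /= eq2.
have idx z : z != q -> index z (q :: q2 :: s) = (index z (q2 :: s)).+1.
  by move=> zq; rewrite [LHS]/= eq_sym (negPf zq).
have idq : index q (q :: q2 :: s) = 0 by rewrite /= eqxx.
have id2 : index q2 (q2 :: s) = 0 by rewrite /= eqxx.
move=> z w zQ wQ' ezw; have [zq|zq] := eqVneq z q.
  by subst z; left; rewrite (q2_uniq w) // idx // idq id2.
have [wq|wq] := eqVneq w q.
  by subst w; right; rewrite (q2_uniq z) 1?eC // idx // idq id2.
rewrite !idx //; have [||->|->] := cs z w _ _ ezw; rewrite ?in_setD1 ?zq ?wq //; auto.
Qed.

End ForestPath.

(** The isomorphism sends a vertex to its index in [c]. Edges at [x] have a hypothesis of their own
    because the closing edge joins the first and the last index. *)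
Lemma cycle_isomorphic (G : sgraph) (x y : G) (s : seq G) :
    let c := x :: y :: s in
    0 < size s -> uniq c -> c =i G -> path adj x (y :: s) -> adj (last y s) x ->
    (forall z w, adj z w -> z != x -> w != x ->
       index w c = (index z c).+1 \/ index z c = (index w c).+1) ->
    (forall w, adj x w -> w = y \/ w = last y s) ->
  is_cycle G.
Proof.
move=> c s0 uc cG pc lx chord nx; exists (size c) => //.
have lt z : index z c < size c by rewrite index_mem cG.
have nthE z : nth x c (index z c) = z by rewrite nth_index ?cG.
pose f z : 'I_(size c) := Ordinal (lt z).
have ix : index x c = 0 by rewrite /c /= eqxx.
have yx : y != x by move: uc; rewrite /c /= inE negb_or eq_sym => /andP[/andP[]].
have iy : index y c = 1 by rewrite /c /= eq_sym (negPf yx) eqxx.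
have il : index (last y s) c = (size s).+1.
  have -> : last y s = nth x c (size s).+1 by rewrite /c (last_nth x).
  by rewrite index_uniq.
have step z w : index w c = (index z c).+1 %% size c -> adj z w.
  move=> E; have := lt z; rewrite leq_eqVlt => /predU1P[zl|zl].
    have -> : w = x.
      by rewrite -(nthE w) E zl modnn.
    suff -> : z = last y s by [].
    by rewrite -(nthE z) (succn_inj zl) (last_nth x).
  rewrite modn_small // in E.
  rewrite -(nthE z) -(nthE w) E.
  by have/(pathP x) := pc; apply; rewrite -ltnS.
exists (f : G -> cycle_graph (size c)).
  exists (fun i : 'I_(size c) => nth x c i) => [z|i]; first exact: nthE.
  by apply: val_inj; exact: (index_uniq x (ltn_ord i) uc).
move=> z w; transitivity (cycle_adj (f z) (f w)) => //.
have fE t : val (f t) = index t c by [].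
have fSE t : val (ordS (f t)) = (index t c).+1 %% size c by [].
rewrite /cycle_adj -!val_eqE !fE !fSE.
apply/andP/idP => [[_ /orP[]/eqP/step//]|zw]; first by rewrite adj_sym.
have zw' : z != w by apply: contraTneq zw => ->; rewrite adj_irrefl.
have nxE w' : adj x w' -> w' != x ->
    (index w' c == 1 %% size c) || (0 == (index w' c).+1 %% size c).
  move=> /nx[]-> _; first by rewrite iy modn_small ?eqxx //.
  by rewrite il modnn eqxx orbT.
split.
  by apply: contra zw' => /eqP E; rewrite -(nthE z) E nthE.
have [zx|zx] := eqVneq z x.
  by subst z; rewrite ix; apply: nxE; rewrite // eq_sym.
have [wx|wx] := eqVneq w x.
  by subst w; rewrite ix orbC; apply: nxE; rewrite // adj_sym.
by case: (chord z w zw zx wx) => E; [have := lt w | have := lt z];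
   rewrite E => /modn_small ->; rewrite eqxx ?orbT.
Qed.

(** Uncovered vertices other than [u] and [b] miss both ends of the only edge [xy] of [M], so they
    have degree at least two in the forest, which is thus a path from [u] to [b]. Since [u] is
    adjacent to [y] and [b] to [x], the edge [xy] closes it. *)
Lemma single_edge_cycle (G : sgraph) k M (p q : G) :
    k < min_degree G -> 2 <= min_degree G ->
    (forall N, matching N -> kconn k (@del_edges_adj G N) -> #|N| <> 2) ->
    removable k 1 M -> p \in ~: cover M -> q \in ~: cover M -> adj p q ->
  is_cycle G.
Proof.
move=> kd d2 maxM remM pU qU pq; have [mM hk _] := remM.
have [_ _ [u [b [x [y [uU bU ub [du _] ud]]]]]] :=
  ends_exist (m := 1) kd d2 maxM remM pU qU pq.
have [[xyM ux uX uy yX] [_ nby bX bx xX]] := ud.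
have xy : adj x y := matching_adj mM xyM.
have nxy : x != y by apply: contraTneq xy => ->; rewrite adj_irrefl.
have Xxy : cover M = [set x; y].
  apply/esym/eqP; rewrite eqEcard (card_X remM) cards2 nxy andbT.
  by apply/subsetP=> z /(mem_cover xyM).
have xU : x \notin ~: cover M by rewrite inE Xxy set21.
have yU : y \notin ~: cover M by rewrite inE Xxy set22.
have UE z : z \in ~: cover M -> del_edges_adj M z =1 adj z.
  by rewrite inE => zX w; rewrite del_edges_uncovered.
have U_deg w : w \in ~: cover M -> k < deg_in (del_edges_adj M) setT w.
  by move=> wU; apply: leq_trans kd (deg_U wU).
have du0 : u != b -> 0 < deg_in (del_edges_adj M) (~: cover M) u by rewrite du.
have [|s [us sU ls ps cs]] :=
  forest_path (del_edges_sym M) (del_edges_irrefl M) hk U_deg (U_cut maxM remM)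
    (subxx _) uU bU du0.
  move=> w wU wu wb; apply: leq_trans d2 _; apply: leq_trans (deg_U wU) _.
  apply: leq_trans (deg_split M w) _; rewrite -[X in _ <= X]addn0 leq_add2l leqn0.
  rewrite -leqn0 leqNgt; apply/deg_in_gt0P => -[z]; rewrite Xxy UE // !inE => /orP[]/eqP->.
    by apply/negP; apply: bx.
  by apply/negP; apply: uy.
have hadj : subrel (del_edges_adj M) (@adj G) by move=> z w /andP[].
have xs : x \notin u :: s by rewrite sU.
have ys : y \notin u :: s by rewrite sU.
have mem z : z != x -> z != y -> z \in ~: cover M by move=> zx zy; rewrite Xxy !inE negb_or zx.
apply: (@cycle_isomorphic G x y (u :: s)) => //.
- by rewrite cons_uniq in_cons negb_or nxy xs cons_uniq ys.
- move=> z; rewrite !in_cons -in_cons sU; case: eqVneq => //= zx; case: eqVneq => //= zy.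
  exact: mem.
- by rewrite /= xy (sub_path hadj ps) andbT adj_sym uX // ?Xxy ?set22 // eq_sym.
- by rewrite /= ls; apply: bX; rewrite // Xxy set21.
- have ic z : z \in ~: cover M -> index z [:: x, y, u & s] = (index z (u :: s)).+2.
    move=> zU; rewrite [LHS]/=.
    have -> : (x == z) = false by apply: contraNF xU => /eqP->.
    by have -> : (y == z) = false by apply: contraNF yU => /eqP->.
  have iy : index y [:: x, y, u & s] = 1 by rewrite [LHS]/= (negPf nxy) eqxx.
  have iu : index u [:: x, y, u & s] = 2 by rewrite ic //= eqxx.
  have ynbr w : w != x -> w != y -> adj y w -> w = u.
    move=> wx wy yw; apply/eqP; apply: contraTT yw => wu; rewrite adj_sym.
    by apply: uy; rewrite ?mem.
  move=> z w zw zx wx; have [zy|zy] := eqVneq z y.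
    subst z; rewrite (ynbr w wx _ zw) ?iy ?iu; first by left.
    by apply: contraTneq zw => ->; rewrite adj_irrefl.
  have [wy|wy] := eqVneq w y.
    by subst w; rewrite (ynbr z zx zy) ?iy ?iu; [right | rewrite adj_sym].
  rewrite !ic ?mem //; have [||] := cs z w (mem z zx zy) (mem w wx wy).
  - by rewrite UE ?mem.
  - by move=> ->; left.
  by move=> ->; right.
move=> w xw; have [|wy] := eqVneq w y; [by left | right].
rewrite /= ls; apply/eqP; apply: contraTT xw => wb; rewrite adj_sym.
have [->|wx] := eqVneq w x; first by rewrite adj_irrefl.
by apply: bx; rewrite ?mem.
Qed.

Lemma complete_isomorphic (G : sgraph) n :
  #|G| = n -> (forall x : G, n <= (degree x).+1) -> isomorphic G (complete_graph n).
Proof.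
move=> Gn; subst n => deg; exists (enum_rank : G -> complete_graph #|G|).
  by exists enum_val; [apply: enum_rankK | apply: enum_valK].
move=> x y; transitivity (enum_rank x != enum_rank y) => //.
rewrite (inj_eq enum_rank_inj).
have [->|xy] := eqVneq x y; first by rewrite adj_irrefl.
apply/esym/negPn/negP => nxy; have := deg x; rewrite /degree.
have : [set z | adj x z] \subset ~: [set x; y].
  apply/subsetP=> z; rewrite !inE negb_or => xz.
  by apply/andP; split; apply: contraTneq xz => ->; rewrite ?adj_irrefl.
move/subset_leq_card; have := cardsC [set x; y]; rewrite cards2 xy; clear; lia.
Qed.

(** Supplies a matching size that is attained while the next one is not, as required by
    [no_larger]. *)
Lemma last_success (P : pred nat) t :
  P 0 -> P t \/ exists n, [/\ n < t, P n & ~~ P n.+1].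
Proof.
move=> P0; elim: t => [|t [Pt|[n [nt Pn Pn1]]]]; first by left.
  by case: (boolP (P t.+1)) => [|nP]; [left | right; exists t].
by right; exists n; split=> //; apply: ltnW.
Qed.

Theorem corollary1p4 (k : nat) (G : sgraph)
  (k_gt0 : 0 < k)
  (G_conn : k_connected k G)
  (G_deg : k + 1 <= min_degree G)
  (not_exc : ~ ((k = 1 /\ is_cycle G) \/
                (~~ odd (min_degree G) /\
                 isomorphic G (complete_graph (min_degree G + 1))))) :
  exists M : {set {set G}},
    k_removable k M /\ #|M| = uphalf (min_degree G + 1).
Proof.
pose P n := [exists M : {set {set G}},
  [&& M \subset edges G, trivIset M, kconn k (del_edges_adj M) & #|M| == n]].
have PP (M : {set {set G}}) : matching M -> kconn k (del_edges_adj M) -> P #|M|.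
  by move=> [ME tM] Mk; apply/existsP; exists M; rewrite ME tM Mk eqxx.
have Gk : kconn k (@adj G) by apply/k_connectedP.
have P0 : P 0.
  have -> : 0 = #|(set0 : {set {set G}})| by rewrite cards0.
  apply: PP; first by split; [apply: sub0set | apply/trivIsetP=> E F; rewrite inE].
  by apply: kconn_sub Gk => x y xy; rewrite /del_edges_adj xy inE.
have [/existsP[M /and4P[ME tM Mk /eqP cM]]|[m [mt /existsP[M]]]] :=
    last_success (uphalf (min_degree G + 1)) P0.
  by exists M; split=> //; split=> //; apply/k_connectedP.
case/and4P=> ME tM Mk /eqP cM nP; exfalso.
have maxM (N : {set {set G}}) : matching N -> kconn k (del_edges_adj N) -> #|N| <> m.+1.
  by move=> mN Nk cN; case/negP: nP; rewrite -cN; apply: PP.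
have md : 2 * m <= min_degree G by move: mt; clear; lia.
have kd : k < min_degree G by rewrite -addn1.
have remM : removable k m M by [].
have cG : #|G| = 2 * m + #|~: cover M| by rewrite -(card_X remM) cardsC.
have degG (x : G) : degree x < #|G|.
  rewrite /degree -cardsT; apply: proper_card; apply/properP.
  by split; [apply: subsetT | exists x; rewrite !inE ?adj_irrefl].
have [x _] : exists x : G, x \in G.
  by apply/card_gt0P; case: G_conn => kG _; apply: leq_ltn_trans kG.
have := degG x; have := min_degree_le x; case: (ltnP 1 #|~: cover M|) => U1 dx xG.
  (* Two uncovered vertices lead to the cycle: an edge between uncovered vertices gives [m = 1], and
     then [k = 1] from [2 * m = k.+1]. *)
  have [p [q [pU qU pq]]] := uncovered_edge kd md maxM remM U1.
  have [d2m dk _] := ends_exist kd md maxM remM pU qU pq.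
  have [m1|m1] := ltnP 1 m.
    by have := no_uncovered_edge kd md maxM m1 remM pU qU; rewrite pq.
  have mE : m = 1 by move: m1 d2m kd k_gt0; clear; lia.
  rewrite mE in maxM remM md d2m.
  apply: not_exc; left; split; first by move: d2m dk; clear; lia.
  exact: single_edge_cycle kd md maxM remM pU qU pq.
(* With at most one uncovered vertex, [G] has at most [2 * m + 1] vertices, but more than
   [min_degree G >= 2 * m]; so both bounds are attained and [G] is complete. *)
have d2m : min_degree G = 2 * m by move: md cG U1 dx xG; clear; lia.
apply: not_exc; right; rewrite d2m mul2n odd_double; split=> //.
apply: complete_isomorphic => [|z]; last by rewrite -mul2n -d2m addn1 ltnS min_degree_le.
move: cG U1 dx xG; rewrite d2m -mul2n; clear; lia.
Qed.
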